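(* Let $G$ be a finite group or a compact Lie group. Let $\mathcal{H}_A,\mathcal{H}_B$ be Hilbert spaces of finite dimensions $d_A,d_B$ with orthonormal bases $\{|i\rangle\}_{i=1}^{d_A}$ and $\{|j\rangle\}_{j=1}^{d_B}$. Let $\Theta$ be a unitary representation of $G$ on $\mathcal{H}_A$, and let $\mathcal{R},\mathcal{L}$ be projective unitary representations of $G$ on $\mathcal{H}_B$ with inverse multipliers $\gamma$ and $\gamma^{-1}$ respectively. Let $A=\{A^i\}_{i=1}^{d_A}$ be $D_1\times D_2$ matrices and $B=\{B^j\}_{j=1}^{d_B}$ be $D_2\times D_1$ matrices such that both the tensor $AB=\{A^iB^j\}_{i,j}$ and the tensor $BA=\{B^jA^i\}_{j,i}$ are normal tensors in canonical form II (CFII). Suppose that the matrix product vector $|\psi^N_{AB}\rangle$ has a local symmetry with respect to $\mathcal{R}(g)\otimes\Theta(g)\otimes\mathcal{L}(g)$: for all $N\ge 2$, any three neighboring sites $2K,2K+1,2K+2$ of the periodic chain of length $2N$ (carrying $\mathcal{H}_B\otimes\mathcal{H}_A\otimes\mathcal{H}_B$), and all $g\in G$, $$\mathcal{R}(g)^{[2K]}\otimes\Theta(g)^{[2K+1]}\otimes\mathcal{L}(g)^{[2K+2]}|\psi^N_{AB}\rangle=|\psi^N_{AB}\rangle .$$ Then there exist projective representations $X(g)$ on $\mathbb{C}^{D_1}$ and $Y(g)$ on $\mathbb{C}^{D_2}$ of $G$, where $X$ has the same multiplier as $\mathcal{R}$ and $Y$ has the inverse of the multiplier of $\mathcal{L}$,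 such that for all $g\in G$ and all $i,j$, $$\sum_{j'}\mathcal{R}(g)_{j,j'}B^{j'}=B^jX(g),\qquad \sum_{j'}\mathcal{L}(g)_{j,j'}B^{j'}=Y(g)^{-1}B^j,\qquad \sum_{i'}\Theta(g)_{i,i'}A^{i'}=X(g)^{-1}A^iY(g).$$
   Context: A multiplier of $G$ is a function $\gamma:G\times G\to U(1)$ with $\gamma(g,h)\gamma(gh,f)=\gamma(g,hf)\gamma(h,f)$ and $\gamma(g,e)=\gamma(e,g)=1$ (continuous if $G$ is a compact Lie group). A projective unitary representation with multiplier $\gamma$ is a map $\Theta$ from $G$ to unitaries with $\Theta(g)\Theta(h)=\gamma(g,h)\Theta(gh)$; a unitary representation is one with trivial multiplier. All (projective) representations are unitary and finite dimensional. Matrix elements are $\Theta(g)_{i,i'}=\langle i|\Theta(g)|i'\rangle$ etc.; a superscript $[K]$ indicates the site (tensor factor) on which an operator acts. The matrix product vector generated by $AB$ is $|\psi^N_{AB}\rangle=\sum\operatorname{Tr}(A^{i_1}B^{j_1}A^{i_2}B^{j_2}\cdots A^{i_N}B^{j_N})|i_1j_1i_2j_2\dots i_Nj_N\rangle$; odd sites carry $\mathcal{H}_A$ and even sites carry $\mathcal{H}_B$, and site labels are taken modulo $2N$. For a tensor $C=\{C^s\}_s$ of square $D\times D$ matrices, the associated completely positive map is $E_C(X)=\sum_sC^sX(C^s)^\dagger$ (sum over all matrices of the tensor). $C$ is normal if for some $L$ the $L$-fold products of its matrices span all $D\times D$ matrices, and $E_C$ has spectral radius $1$. A normal tensor $C$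 is in canonical form II (CFII) if $E_C$ is trace preserving and has a diagonal, positive definite (full rank) fixed point. *)

(* Defs.v *)
(* The complex numbers are R[i] for an arbitrary R : realType. *)
From HB Require Import structures.
From mathcomp Require Export all_boot all_order all_algebra.
From mathcomp Require Export sesquilinear spectral.
From mathcomp Require Export all_classical all_reals all_analysis.
From mathcomp Require Export complex.
Export numFieldNormedType.Exports.

#[export] Set Implicit Arguments.
#[export] Unset Strict Implicit.
#[export] Unset Printing Implicit Defensive.

Import Order.TTheory GRing.Theory Num.Theory.
Local Open Scope classical_set_scope.
Local Open Scope ring_scope.
Local Open Scope complex_scope.
Local Open Scope sesquilinear_scope.

(* The topology of R[i] given by its modulus. *)
HB.instance Definition _ (R : realType) :=
  NormedModule.copy R[i] (R[i] : numClosedFieldType)^o.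

HB.mixin Record isTopologicalGroup G & Group G & Topological G := {
  mulg_continuous : continuous (fun p : G * G => (p.1 * p.2)%g) ;
  invg_continuous : continuous (fun x : G => (x^-1)%g) ;
}.

#[short(type="topologicalGroupType")]
HB.structure Definition TopologicalGroup :=
  {G of Group G & Topological G & isTopologicalGroup G}.

Section Smooth.
Context {R : realType}.

(* On an open subset U of a finite-dimensional space this is the class C^k on
   U: all iterated directional derivatives of order at most k exist on U, and
   those of order k are continuous on U. *)
Fixpoint class_C {V W : normedModType R} (k : nat) (U : set V) (f : V -> W)
    : Prop :=
  match k with
  | 0 => forall x, U x -> {for x, continuous f}
  | k.+1 => (forall x v, U x -> derivable f x v) /\
            (forall v, class_C k U ('D_v f))
  end.

Definition smooth_on {V W : normedModType R} (U : set V) (f : V -> W) : Prop :=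
  forall k, class_C k U f.

Record chart (G : Type) (n : nat) := Chart {
  chart_dom : set G ;
  chart_map :> G -> 'rV[R]_n ;
  chart_inv : 'rV[R]_n -> G (* junk outside of the image of the chart *)
}.

Definition chart_im (G : Type) (n : nat) (c : chart G n) : set 'rV[R]_n :=
  c @` chart_dom c.

Definition is_chart (G : topologicalType) (n : nat) (c : chart G n) : Prop :=
  [/\ open (chart_dom c), open (chart_im c),
      {in chart_dom c, cancel c (chart_inv c)},
      {within chart_dom c, continuous c} &
      {within chart_im c, continuous (chart_inv c)}].

Definition smooth_atlas (G : topologicalType) (n : nat) (A : set (chart G n))
    : Prop :=
  [/\ forall c, A c -> is_chart c,
      forall x : G, exists2 c, A c & chart_dom c x &
      forall c1 c2, A c1 -> A c2 ->
        smooth_on (c1 @` (chart_dom c1 `&` chart_dom c2))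
                  (c2 \o chart_inv c1)].

Definition smooth_mulg (G : topologicalGroupType) (n : nat)
    (A : set (chart G n)) : Prop :=
  forall c1 c2 c3, A c1 -> A c2 -> A c3 ->
    let m (p : 'rV[R]_n * 'rV[R]_n) :=
      (chart_inv c1 p.1 * chart_inv c2 p.2)%g in
    smooth_on [set p | [/\ chart_im c1 p.1, chart_im c2 p.2 &
                           chart_dom c3 (m p)]] (c3 \o m).

Definition smooth_invg (G : topologicalGroupType) (n : nat)
    (A : set (chart G n)) : Prop :=
  forall c1 c2, A c1 -> A c2 ->
    let m (p : 'rV[R]_n) := ((chart_inv c1 p)^-1)%g in
    smooth_on [set p | chart_im c1 p /\ chart_dom c2 (m p)] (c2 \o m).

End Smooth.

Arguments chart : clear implicits.

(* Second countability follows from compactness and the existence of charts. *)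
Definition compact_lie_group (R : realType) (G : topologicalGroupType) : Prop :=
  [/\ compact [set: G], hausdorff_space G &
      exists (n : nat) (A : set (chart R G n)),
        [/\ smooth_atlas A, smooth_mulg A & smooth_invg A]].

(* Finite groups carry the discrete topology, so that continuity requirements
   are void for them. *)
Definition finite_group (G : topologicalGroupType) : Prop :=
  finite_set [set: G] /\ forall x : G, open [set x].

Section ProjectiveRepresentations.
Context {R : realType} {G : topologicalGroupType}.

Definition multiplier (gamma : G -> G -> R[i]) : Prop :=
  [/\ forall g h, `|gamma g h| = 1,
      forall g h f, gamma g h * gamma (g * h)%g f
                    = gamma g (h * f)%g * gamma h f,
      forall g, gamma g 1%g = 1 /\ gamma 1%g g = 1 &
      continuous (fun p : G * G => gamma p.1 p.2)].

Definition proj_rep (gamma : G -> G -> R[i]) (n : nat) (T : G -> 'M[R[i]]_n)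
    : Prop :=
  [/\ multiplier gamma,
      forall g, T g \is unitarymx &
      forall g h, T g *m T h = gamma g h *: T (g * h)%g].

Definition unitary_rep (n : nat) (T : G -> 'M[R[i]]_n) : Prop :=
  proj_rep (fun _ _ => 1) T.

Definition inv_multiplier (gamma : G -> G -> R[i]) : G -> G -> R[i] :=
  fun g h => (gamma g h)^-1.

End ProjectiveRepresentations.

Section Tensors.
Context {R : realType}.

Definition cp_map (I : finType) (D : nat) (C : I -> 'M[R[i]]_D)
    (X : 'M[R[i]]_D) : 'M[R[i]]_D :=
  \sum_s C s *m X *m (C s)^t*.

Definition spectral_radius (D : nat) (E : 'M[R[i]]_D -> 'M[R[i]]_D) : R :=
  sup [set r : R | exists2 l : R[i], eigenvalue (lin_mx E) l & `|l| = r%:C].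

Definition normal_tensor (I : finType) (D : nat) (C : I -> 'M[R[i]]_D) : Prop :=
  (exists L : nat,
     (<<[seq \big[mulmx/1%:M]_(s <- w) C s | w : L.-tuple I]>> = fullv)%VS) /\
  spectral_radius (cp_map C) = 1.

Definition posdefmx (D : nat) (P : 'M[R[i]]_D) : Prop :=
  forall v : 'rV[R[i]]_D, v != 0 -> 0 < (v *m P *m v^t*) 0 0.

Definition normal_CFII (I : finType) (D : nat) (C : I -> 'M[R[i]]_D) : Prop :=
  [/\ normal_tensor C,
      forall X, \tr (cp_map C X) = \tr X &
      exists P : 'M[R[i]]_D,
        [/\ is_diag_mx P, posdefmx P & cp_map C P = P]].

Definition tensor_mul (I J : finType) (D1 D2 : nat)
    (A : I -> 'M[R[i]]_(D1, D2)) (B : J -> 'M[R[i]]_(D2, D1))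
    : I * J -> 'M[R[i]]_D1 :=
  fun s => A s.1 *m B s.2.

End Tensors.

Section Chain.
Context {R : realType} {dA dB : nat}.

(* Basis labels of the chain of length 2N.  The site 2k+1 (k = 0, ..., N-1) is
   the A-component of the k-th entry, the site 2k+2 its B-component. *)
Definition config (N : nat) := {ffun 'I_N -> 'I_dA * 'I_dB}.

Definition state (N : nat) := {ffun config N -> R[i]}.

Definition mpv (D1 D2 N : nat) (A : 'I_dA -> 'M[R[i]]_(D1, D2))
    (B : 'I_dB -> 'M[R[i]]_(D2, D1)) : state N :=
  [ffun s : config N =>
     \tr (\big[mulmx/1%:M]_(k < N) (A (s k).1 *m B (s k).2))].

Definition setA (N : nat) (s : config N) (k : 'I_N) (i : 'I_dA) : config N :=
  [ffun l => if l == k then (i, (s l).2) else s l].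

Definition setB (N : nat) (s : config N) (k : 'I_N) (j : 'I_dB) : config N :=
  [ffun l => if l == k then ((s l).1, j) else s l].

(* The operator M^[2k+1], i.e. M on that tensor factor, identity elsewhere. *)
Definition opA (N : nat) (M : 'M[R[i]]_dA) (k : 'I_N) (psi : state N)
    : state N :=
  [ffun s : config N => \sum_i M (s k).1 i * psi (setA s k i)].

(* The operator M^[2k+2]. *)
Definition opB (N : nat) (M : 'M[R[i]]_dB) (k : 'I_N) (psi : state N)
    : state N :=
  [ffun s : config N => \sum_j M (s k).2 j * psi (setB s k j)].

(* The three sites are the B-site of the k-th entry and both sites of the next
   entry modulo N; for N >= 2 they are distinct and the composition below is
   the tensor product Rr (x) Th (x) Lr on them. *)
Definition local_symmetry (G : Type) (Rr : G -> 'M[R[i]]_dB)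
    (Th : G -> 'M[R[i]]_dA) (Lr : G -> 'M[R[i]]_dB)
    (psi : forall N, state N) : Prop :=
  forall N : nat, (2 <= N)%N -> forall (k : 'I_N) (g : G),
    opB (Rr g) k (opA (Th g) (ordS k) (opB (Lr g) (ordS k) (psi N))) = psi N.

End Chain.

(* Main.v *)
Require Import Defs.
Import Order.TTheory GRing.Theory Num.Theory.
Local Open Scope classical_set_scope.
Local Open Scope ring_scope.
Local Open Scope complex_scope.
Local Open Scope sesquilinear_scope.

(* Write B_R, A_T, B_L for the tensors after the local action.  Since words of AB
   of some length L span the full matrix algebra, the symmetry of the chain with
   N = L + 2 and nondegeneracy of the trace give the local identity
   B_R^j A_T^i B_L^k = B^j A^i B^k.  Trace preservation and the full rank fixed
   points of AB and BA provide left and right inverses of the families A and B,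
   and cancelling the outer factors gives B_R = B X, B_L = Y^-1 B and
   A_T = X^-1 A Y.  By cancellation again, X and Y are unique, which gives the
   multipliers.  Trace preservation reads sum B^* a B = 1 and sum A^* b A = 1,
   with a = sum A^* A and b = sum B^* B: unitarity of the action turns the first
   one into X^* X = 1, and, as also X^* b X = b, the second one into Y^* Y = 1.
   Continuity holds since X and Y^* are linear in the local actions. *)

(** * One-sided inverses of matrix families and operators acting on their index *)

Section MatrixFamilies.
Context {F : fieldType}.

(** In block form the row [K] is a left inverse of the column [C]; [dual_fam C O] makes the column
    [O] a right inverse of the row [C]. *)
Definition dual_fam (I : finType) (m n : nat) (K : I -> 'M[F]_(n, m))
    (C : I -> 'M[F]_(m, n)) : Prop := \sum_s K s *m C s = 1%:M.

Lemma left_cancel (I : finType) (m n p : nat) (K : I -> 'M[F]_(n, m))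
    (C : I -> 'M[F]_(m, n)) (Z Z' : 'M[F]_(n, p)) :
  dual_fam K C -> (forall s, C s *m Z = C s *m Z') -> Z = Z'.
Proof.
move=> KC CZ; rewrite -[Z]mul1mx -[Z']mul1mx -KC !mulmx_suml.
by apply: eq_bigr => s _; rewrite -!mulmxA CZ.
Qed.

Lemma right_cancel (I : finType) (m n p : nat) (C : I -> 'M[F]_(m, n))
    (K : I -> 'M[F]_(n, m)) (Z Z' : 'M[F]_(p, m)) :
  dual_fam C K -> (forall s, Z *m C s = Z' *m C s) -> Z = Z'.
Proof.
move=> CK ZC; rewrite -[Z]mulmx1 -[Z']mulmx1 -CK !mulmx_sumr.
by apply: eq_bigr => s _; rewrite !mulmxA ZC.
Qed.

(** Grouping the sum by [j] absorbs each [A i] into the left inverse, so the last factor of a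
    product inherits one. *)
Lemma dual_fam_snd (I J : finType) (m n p : nat) (A : I -> 'M[F]_(m, n))
    (B : J -> 'M[F]_(n, p)) (K : I * J -> 'M[F]_(p, m)) :
  dual_fam K (fun s => A s.1 *m B s.2) ->
  dual_fam (fun j => \sum_i K (i, j) *m A i) B.
Proof.
rewrite /dual_fam => <-; under eq_bigr do rewrite mulmx_suml.
rewrite exchange_big pair_big; apply: eq_bigr => -[i j] _ /=.
by rewrite mulmxA.
Qed.

Lemma dual_fam_fst (I J : finType) (m n p : nat) (A : I -> 'M[F]_(m, n))
    (B : J -> 'M[F]_(n, p)) (K : I * J -> 'M[F]_(p, m)) :
  dual_fam (fun s => A s.1 *m B s.2) K ->
  dual_fam A (fun i => \sum_j B j *m K (i, j)).
Proof.
rewrite /dual_fam => <-; under eq_bigr do rewrite mulmx_sumr.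
by rewrite pair_big; apply: eq_bigr => -[i j] _ /=; rewrite mulmxA.
Qed.

(** The action of an operator on the physical index; the three intertwining relations have it on
    their left sides. *)
Definition mix (d m n : nat) (M : 'M[F]_d) (C : 'I_d -> 'M[F]_(m, n))
    (j : 'I_d) : 'M[F]_(m, n) := \sum_j' M j j' *: C j'.

Lemma mix_mul (d m n : nat) (M M' : 'M[F]_d) (C : 'I_d -> 'M[F]_(m, n)) j :
  mix M (mix M' C) j = mix (M *m M') C j.
Proof.
rewrite /mix; under eq_bigr do rewrite scaler_sumr.
rewrite exchange_big /=; apply: eq_bigr => k _.
by rewrite mxE scaler_suml; apply: eq_bigr => l _; rewrite scalerA.
Qed.

Lemma mix1 (d m n : nat) (C : 'I_d -> 'M[F]_(m, n)) j : mix 1%:M C j = C j.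
Proof.
rewrite /mix (bigD1 j) //= mxE eqxx scale1r big1 ?addr0 // => k kj.
by rewrite mxE eq_sym (negPf kj) scale0r.
Qed.

Lemma mix_scale (d m n : nat) c (M : 'M[F]_d) (C : 'I_d -> 'M[F]_(m, n)) j :
  mix (c *: M) C j = c *: mix M C j.
Proof.
by rewrite /mix scaler_sumr; apply: eq_bigr => k _; rewrite mxE scalerA.
Qed.

Lemma mix_mulr (d m n p : nat) (M : 'M[F]_d) (C : 'I_d -> 'M[F]_(m, n))
    (Z : 'M[F]_(n, p)) j :
  mix M (fun k => C k *m Z) j = mix M C j *m Z.
Proof.
by rewrite /mix mulmx_suml; apply: eq_bigr => k _; rewrite -scalemxAl.
Qed.

Lemma mix_mull (d m n p : nat) (M : 'M[F]_d) (C : 'I_d -> 'M[F]_(m, n))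
    (Z : 'M[F]_(p, m)) j :
  mix M (fun k => Z *m C k) j = Z *m mix M C j.
Proof.
by rewrite /mix mulmx_sumr; apply: eq_bigr => k _; rewrite -scalemxAr.
Qed.

Lemma eq_mix (d m n : nat) (M : 'M[F]_d) (C C' : 'I_d -> 'M[F]_(m, n)) j :
  C =1 C' -> mix M C j = mix M C' j.
Proof. by move=> CC'; apply: eq_bigr => k _; rewrite CC'. Qed.

(** Stripping the first or the last factor of the identity moves the action on it into [X'] or [Y].
    Putting the results back and cancelling the untouched factors gives the relations for [B]. *)
Lemma gauge_intertwiners (d e D1 D2 : nat) (U V : 'M[F]_e)
    (A A' : 'I_d -> 'M[F]_(D1, D2)) (B : 'I_e -> 'M[F]_(D2, D1))
    (KA OA : 'I_d -> 'M[F]_(D2, D1)) (KB OB : 'I_e -> 'M[F]_(D1, D2)) :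
  dual_fam KA A -> dual_fam A OA ->
  dual_fam KB B -> dual_fam B OB ->
  U \in unitmx -> V \in unitmx ->
  (forall j i k, mix U B j *m A' i *m mix V B k = B j *m A i *m B k) ->
  exists (X : 'M[F]_D1) (Y : 'M[F]_D2),
    [/\ X \in unitmx, Y \in unitmx,
        forall j, mix U B j = B j *m X,
        forall k, mix V B k = invmx Y *m B k &
        forall i, A' i = invmx X *m A i *m Y].
Proof.
move=> KA1 OA1 KB1 OB1 Uu Vu BAB.
(* [X'] is the inverse of the [X] sought: undo [U] on the first factor, then contract with [KB]. *)
pose X' := \sum_j KB j *m mix (invmx U) B j.
pose Y := \sum_k mix (invmx V) B k *m OB k.
have A'BV i k : A' i *m mix V B k = X' *m A i *m B k.
  rewrite -[LHS]mul1mx -KB1 !mulmx_suml; apply: eq_bigr => j _.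
  (* Writing [B j] as [invmx U] acting on [mix U B] lets the identity apply under the outer
     [mix]. *)
  rewrite -[in LHS](mix1 B j) -(mulVmx Uu) -mix_mul -!mulmxA; congr (_ *m _).
  rewrite -!mix_mulr; apply: eq_mix => l.
  by rewrite mulmxA BAB mulmxA.
have BUA' j i : mix U B j *m A' i = B j *m A i *m Y.
  rewrite -[LHS]mulmx1 -OB1 !mulmx_sumr; apply: eq_bigr => k _.
  rewrite -[in LHS](mix1 B k) -(mulVmx Vu) -mix_mul !mulmxA; congr (_ *m _).
  rewrite -!mix_mull; apply: eq_mix => l.
  by rewrite BAB.
have BUX' j : mix U B j *m X' = B j.
  apply: (right_cancel OA1) => i; apply: (right_cancel OB1) => k.
  by rewrite -BAB -!mulmxA A'BV !mulmxA.
have YBV k : Y *m mix V B k = B k.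
  apply: (left_cancel KA1) => i; apply: (left_cancel KB1) => j.
  by rewrite !mulmxA -BUA' BAB.
(* For square matrices a one-sided inverse is enough for invertibility. *)
have X'l : (\sum_j KB j *m mix U B j) *m X' = 1%:M.
  by rewrite mulmx_suml -[RHS]KB1; apply: eq_bigr => j _; rewrite -mulmxA BUX'.
have Yr : Y *m (\sum_k mix V B k *m OB k) = 1%:M.
  by rewrite mulmx_sumr -[RHS]OB1; apply: eq_bigr => k _; rewrite mulmxA YBV.
have [_ X'u] := mulmx1_unit X'l.
have [Yu _] := mulmx1_unit Yr.
have BX j : mix U B j = B j *m invmx X' by rewrite -[B j]BUX' mulmxK.
exists (invmx X'), Y; split => //.
- by rewrite unitmx_inv.
- by move=> k; rewrite -[B k]YBV mulKmx.
- move=> i; rewrite invmxK; apply: (can_inj (mulKmx (_ : invmx X' \in unitmx))).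
    by rewrite unitmx_inv.
  apply: (left_cancel KB1) => j.
  by rewrite mulmxA -BX BUA' !mulmxA mulmxKV.
Qed.

(** * Nondegeneracy of the trace and the local identity *)

Lemma mxtrace_mul_inj (D : nat) (M M' : 'M[F]_D) :
  (forall W, \tr (M *m W) = \tr (M' *m W)) -> M = M'.
Proof.
move=> MM'; apply/matrixP => i j.
have trE (N : 'M[F]_D) : \tr (N *m delta_mx j i) = N i j.
  rewrite /mxtrace (bigD1 i) //= mxE (bigD1 j) //= mxE !eqxx mulr1.
  rewrite !big1 ?addr0 // => k ki; last by rewrite mxE (negPf ki) mulr0.
  by rewrite mxE big1 // => l _; rewrite mxE (negPf ki) andbF mulr0.
by rewrite -!trE MM'.
Qed.

Lemma mxtrace_span_inj (D : nat) (ws : seq 'M[F]_D) (M M' : 'M[F]_D) :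
  <<ws>>%VS = fullv -> (forall W, W \in ws -> \tr (M *m W) = \tr (M' *m W)) ->
  M = M'.
Proof.
move=> wsT MM'; apply: mxtrace_mul_inj => W.
have /coord_span -> : W \in <<in_tuple ws>>%VS by rewrite wsT memvf.
rewrite !mulmx_sumr !raddf_sum; apply: eq_bigr => i _ /=.
by rewrite -!scalemxAr !mxtraceZ MM' // mem_nth.
Qed.

End MatrixFamilies.

Lemma mxtrace_mix (F : fieldType) (d m n p : nat) (M : 'M[F]_d)
    (C : 'I_d -> 'M[F]_(m, n)) (P : 'M[F]_(p, m)) (Q : 'M[F]_(n, p)) j :
  \tr (P *m mix M C j *m Q) = \sum_j' M j j' * \tr (P *m C j' *m Q).
Proof.
rewrite /mix mulmx_sumr mulmx_suml raddf_sum; apply: eq_bigr => k _ /=.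
by rewrite -scalemxAr -scalemxAl mxtraceZ.
Qed.

(** In a chain of [L.+2] entries the first two contain the three sites acted on, and the other [L]
    run over words that span all matrices. The first entry begins with an [A]-site outside the
    action, hence the extra factor [A i0]. *)
Lemma local_symmetry_tensors (R : realType) (dA dB D1 D2 : nat)
    (A : 'I_dA -> 'M[R[i]]_(D1, D2)) (B : 'I_dB -> 'M[R[i]]_(D2, D1))
    (U V : 'M[R[i]]_dB) (T : 'M[R[i]]_dA) (L : nat) :
  <<[seq \big[mulmx/1%:M]_(s <- w) tensor_mul A B s
       | w : L.-tuple ('I_dA * 'I_dB)]>>%VS = fullv ->
  (let k := ord0 : 'I_L.+2 in
   opB U k (opA T (ordS k) (opB V (ordS k) (mpv L.+2 A B))) = mpv L.+2 A B) ->
  forall i0 j i k,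
    A i0 *m mix U B j *m mix T A i *m mix V B k
    = A i0 *m B j *m A i *m B k.
Proof.
move=> spanL /= sym i0 j i k.
apply: (mxtrace_span_inj spanL) => _ /mapP [w _ ->].
(* The first entry is [(i0, j)], the second [(i, k)], and the remaining ones spell the word [w]. *)
pose cfg j i k : @config dA dB L.+2 := [ffun l =>
  if unlift ord0 l is Some l' then
    if unlift ord0 l' is Some l'' then tnth w l'' else (i, k)
  else (i0, j)].
have S0 : ordS ord0 = lift ord0 ord0 :> 'I_L.+2 by apply: val_inj.
rewrite S0 in sym.
have cfgB0 j1 i1 k1 j2 : setB (cfg j1 i1 k1) ord0 j2 = cfg j2 i1 k1.
  apply/ffunP => l; rewrite !ffunE.
  by case: unliftP => [l' ->|->] //=.
have cfgA1 j1 i1 k1 i2 :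
    setA (cfg j1 i1 k1) (lift ord0 ord0) i2 = cfg j1 i2 k1.
  apply/ffunP => l; rewrite !ffunE.
  case: unliftP => [l' ->|->] //=; rewrite (inj_eq lift_inj).
  by case: unliftP => [l'' ->|->].
have cfgB1 j1 i1 k1 k2 :
    setB (cfg j1 i1 k1) (lift ord0 ord0) k2 = cfg j1 i1 k2.
  apply/ffunP => l; rewrite !ffunE.
  case: unliftP => [l' ->|->] //=; rewrite (inj_eq lift_inj).
  by case: unliftP => [l'' ->|->].
have cfg0 j1 i1 k1 : cfg j1 i1 k1 ord0 = (i0, j1).
  by rewrite ffunE unlift_none.
have cfg1 j1 i1 k1 : cfg j1 i1 k1 (lift ord0 ord0) = (i1, k1).
  by rewrite ffunE liftK unlift_none.
have mpvE j1 i1 k1 : mpv L.+2 A B (cfg j1 i1 k1) =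
    \tr (A i0 *m B j1 *m A i1 *m B k1
         *m \big[mulmx/1%:M]_(s <- w) tensor_mul A B s).
  rewrite ffunE !big_ord_recl cfg0 cfg1 big_tuple !mulmxA.
  congr (\tr (_ *m _)); apply: eq_bigr => l _.
  by rewrite ffunE !liftK.
rewrite -[RHS]mpvE -sym.
(* The three operators are peeled off from the outermost inwards, each matched with the [mix] at its
   own site. *)
rewrite ffunE cfg0 -!(mulmxA (A i0 *m _)) mxtrace_mix /=.
apply: eq_bigr => j' _; congr (_ * _).
rewrite cfgB0 ffunE cfg1 !mulmxA -mulmxA mxtrace_mix.
apply: eq_bigr => i' _; congr (_ * _).
rewrite cfgA1 ffunE cfg1 !mulmxA mxtrace_mix.
by apply: eq_bigr => k' _; rewrite cfgB1 mpvE.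
Qed.

(** * Adjoints, consequences of the canonical form, and unitarity of the gauge matrices *)

Section Adjoint.
Context {R : realType}.
Local Notation C := R[i].

Lemma adjmxM (m n p : nat) (M : 'M[C]_(m, n)) (N : 'M[C]_(n, p)) :
  (M *m N)^t* = N^t* *m M^t*.
Proof. by rewrite trmx_mul map_mxM. Qed.

Lemma adjmx_sum (I : finType) (m n : nat) (T : I -> 'M[C]_(m, n)) :
  (\sum_s T s)^t* = \sum_s (T s)^t*.
Proof.
apply/matrixP => i j; rewrite !(mxE, summxE) rmorph_sum.
by apply: eq_bigr => s _; rewrite !mxE.
Qed.

Lemma adjmxZ (m n : nat) a (M : 'M[C]_(m, n)) : (a *: M)^t* = a^* *: M^t*.
Proof. by apply/matrixP => i j; rewrite !mxE rmorphM. Qed.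

(** Unitary freedom of Kraus operators: after expansion the coefficients sum to the entries of
    [U^t* *m U = 1], so only the terms with [k = l] survive. *)
Lemma mix_unitary_sum (d m n : nat) (U : 'M[C]_d) (B : 'I_d -> 'M[C]_(m, n))
    (M : 'M[C]_m) :
  U \is unitarymx ->
  \sum_j (mix U B j)^t* *m M *m mix U B j = \sum_j (B j)^t* *m M *m B j.
Proof.
move=> /unitarymxP /mulmx1C UU.
have E j : (mix U B j)^t* *m M *m mix U B j =
   \sum_k \sum_l ((U j k)^* * U j l) *: ((B k)^t* *m M *m B l).
  rewrite adjmx_sum !mulmx_suml; apply: eq_bigr => k _.
  rewrite mulmx_sumr; apply: eq_bigr => l _.
  by rewrite adjmxZ -!scalemxAl -scalemxAr scalerA.
under eq_bigr do rewrite E.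
rewrite exchange_big /=; apply: eq_bigr => k _.
rewrite exchange_big /= (bigD1 k) //= -scaler_suml [X in _ + X]big1 ?addr0.
  have := congr1 (fun Z : 'M[C]_d => Z k k) UU; rewrite !mxE eqxx => Ukk.
  rewrite -[RHS]scale1r; congr (_ *: _); rewrite -[RHS]Ukk.
  by apply: eq_bigr => j _; rewrite !mxE.
move=> l lk; rewrite -scaler_suml.
have := congr1 (fun Z : 'M[C]_d => Z k l) UU.
rewrite !mxE eq_sym (negPf lk) => Ukl.
rewrite [X in X *: _](_ : _ = 0) ?scale0r //; apply: etrans Ukl.
by apply: eq_bigr => j _; rewrite !mxE.
Qed.

(** The trace pairing turns trace preservation into unitality of the adjoint map. *)
Lemma cp_map_trace_preserving (I : finType) (D : nat) (T : I -> 'M[C]_D) :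
  (forall X, \tr (cp_map T X) = \tr X) -> \sum_s (T s)^t* *m T s = 1%:M.
Proof.
move=> TP; apply: mxtrace_mul_inj => W.
rewrite mul1mx -(TP W) /cp_map mulmx_suml !raddf_sum; apply: eq_bigr => s _ /=.
by rewrite -[in LHS]mulmxA mxtrace_mulC.
Qed.

Lemma posdefmx_unit (D : nat) (P : 'M[C]_D) : posdefmx P -> P \in unitmx.
Proof.
move=> Ppos; rewrite -row_free_unit -kermx_eq0; apply/eqP/row_matrixP => k.
rewrite linear0; apply/eqP; apply: contraT => /Ppos.
by rewrite -row_mul mulmx_ker linear0 mul0mx mxE ltxx.
Qed.

(** Trace preservation gives the left inverse; the fixed-point equation times [invmx P] gives the
    right one. *)
Lemma normal_CFII_dual (I : finType) (D : nat) (T : I -> 'M[C]_D) :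
  normal_CFII T -> exists K O, dual_fam K T /\ dual_fam T O.
Proof.
move=> [_ TP [P [_ /posdefmx_unit Pu fixP]]].
exists (fun s => (T s)^t*), (fun s => P *m (T s)^t* *m invmx P); split.
  exact: cp_map_trace_preserving.
rewrite /dual_fam; transitivity (cp_map T P *m invmx P); last first.
  by rewrite fixP mulmxV.
rewrite mulmx_suml; apply: eq_bigr => s _.
by rewrite !mulmxA.
Qed.

Lemma normal_CFII_adj_sum (I J : finType) (m n : nat) (A : I -> 'M[C]_(m, n))
    (B : J -> 'M[C]_(n, m)) :
  normal_CFII (tensor_mul A B) ->
  \sum_j (B j)^t* *m (\sum_i (A i)^t* *m A i) *m B j = 1%:M.
Proof.
move=> [_ /cp_map_trace_preserving <- _].
under eq_bigr do rewrite mulmx_sumr mulmx_suml.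
rewrite exchange_big pair_big; apply: eq_bigr => -[i j] _ /=.
by rewrite /tensor_mul adjmxM !mulmxA.
Qed.

Lemma gauge_unitary (d e D1 D2 : nat) (T : 'M[C]_d) (U : 'M[C]_e)
    (A : 'I_d -> 'M[C]_(D1, D2)) (B : 'I_e -> 'M[C]_(D2, D1))
    (X : 'M[C]_D1) (Y : 'M[C]_D2) :
  normal_CFII (tensor_mul A B) -> normal_CFII (tensor_mul B A) ->
  T \is unitarymx -> U \is unitarymx ->
  (forall j, mix U B j = B j *m X) ->
  (forall i, mix T A i = invmx X *m A i *m Y) ->
  X \is unitarymx /\ Y \is unitarymx.
Proof.
move=> /normal_CFII_adj_sum AB1 /normal_CFII_adj_sum BA1 Tu Uu BX AXY.
(* Both [M = \sum_i (A i)^t* *m A i], where the sum is the identity, and [M = 1], where it is [b],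
   are used below. *)
have BXE M : X^t* *m (\sum_j (B j)^t* *m M *m B j) *m X =
    \sum_j (B j)^t* *m M *m B j.
  rewrite -[RHS](mix_unitary_sum _ _ Uu) mulmx_sumr mulmx_suml.
  by apply: eq_bigr => j _; rewrite BX adjmxM !mulmxA.
have X1 : X^t* *m X = 1%:M.
  by move: (BXE (\sum_i (A i)^t* *m A i)); rewrite AB1 mulmx1.
have XX1 := mulmx1C X1.
have Xu : X \is unitarymx by apply/unitarymxP.
split=> //; apply/unitarymxP/mulmx1C.
set b := \sum_j (B j)^t* *m B j in BA1.
have bE : b = \sum_j (B j)^t* *m 1%:M *m B j.
  by apply: eq_bigr => j _; rewrite mulmx1.
(* The adjoint of [invmx X *m A i *m Y] puts [X] to the left of [b], so the invariance is needed in
   this order. *)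
have XbX : X *m b *m X^t* = b.
  rewrite -[in LHS](_ : X^t* *m b *m X = b); last by rewrite bE BXE.
  by rewrite !mulmxA XX1 mul1mx -mulmxA XX1 mulmx1.
transitivity (Y^t* *m (\sum_i (A i)^t* *m b *m A i) *m Y).
  by rewrite BA1 mulmx1.
rewrite -[RHS]BA1 -[in RHS](mix_unitary_sum A b Tu) mulmx_sumr mulmx_suml.
apply: eq_bigr => i _.
by rewrite AXY invmx_unitary // !adjmxM trmxCK -[in LHS]XbX !mulmxA.
Qed.

End Adjoint.

(** * Continuity of matrix-valued maps *)

Section Continuity.

Lemma continuous_mx (S T : topologicalType) (m n : nat)
    (f : S -> 'M[T]_(m, n)) :
  (forall i j, continuous (fun x => f x i j)) -> continuous f.
Proof.
move=> fc x E [P xP sPE].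
apply: filterS (_ : \forall y \near x, forall i j, P i j (f y i j)).
  by move=> y; exact: sPE.
apply: filter_forall => i; apply: filter_forall => j.
exact: (fc i j x _ (xP i j)).
Qed.

Context {R : realType} {S : topologicalType}.
Local Notation C := R[i].

Lemma continuous_conj : continuous (fun z : C => z^*).
Proof.
move=> z E /nbhs_ballP [e e0 sE]; apply/nbhs_ballP.
exists e => // w zw; apply: sE; move: zw.
by rewrite /= -!ball_normE /= -rmorphB norm_conjC.
Qed.

Lemma continuous_adjmx (m n : nat) (f : S -> 'M[C]_(m, n)) :
  continuous f -> continuous (fun x => (f x)^t*).
Proof.
move=> fc; apply: continuous_mx => i j x.
under eq_fun do rewrite !mxE.
apply: (@continuous_comp _ _ _ (fun y => f y j i) (fun z => z^*)).
  apply: (@continuous_comp _ _ _ f (fun M : 'M[C]_(m, n) => M j i)).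
    exact: fc.
  exact: coord_continuous.
exact: continuous_conj.
Qed.

(** Each entry is a linear combination of entries of [f x] with constant coefficients. The factors
    [P] and [Q] cover the formulas for both [X] and the adjoint of [Y]. *)
Lemma continuous_mix_sum (d m n p q : nat) (f : S -> 'M[C]_d)
    (B : 'I_d -> 'M[C]_(m, n)) (P : 'I_d -> 'M[C]_(p, m))
    (Q : 'I_d -> 'M[C]_(n, q)) :
  continuous f -> continuous (fun x => \sum_j P j *m mix (f x) B j *m Q j).
Proof.
move=> fc; apply: continuous_mx => a b.
have E x : (\sum_j P j *m mix (f x) B j *m Q j) a b =
    \sum_j \sum_k (P j *m B k *m Q j) a b * f x j k.
  rewrite summxE; apply: eq_bigr => j _.
  rewrite /mix mulmx_sumr mulmx_suml summxE; apply: eq_bigr => k _.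
  by rewrite -scalemxAr -scalemxAl mxE mulrC.
under eq_fun do rewrite E.
apply: continuous_big => [|j _]; first exact: add_continuous.
apply: continuous_big => [|k _]; first exact: add_continuous.
move=> x; apply: (@cvgMl_tmp C).
apply: (@continuous_comp _ _ _ f (fun M : 'M[C]_d => M j k)).
  exact: fc.
exact: coord_continuous.
Qed.

End Continuity.

(** * Choice of the gauge matrices, their multipliers and continuity *)

Theorem theorem3 (R : realType) (G : topologicalGroupType)
    (hG : finite_group G \/ compact_lie_group R G)
    (dA dB D1 D2 : nat) (gamma : G -> G -> R[i])
    (Th : G -> 'M[R[i]]_dA) (Rr Lr : G -> 'M[R[i]]_dB)
    (hTh : unitary_rep Th)
    (hRr : proj_rep gamma Rr)
    (hLr : proj_rep (inv_multiplier gamma) Lr)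
    (A : 'I_dA -> 'M[R[i]]_(D1, D2)) (B : 'I_dB -> 'M[R[i]]_(D2, D1))
    (hAB : normal_CFII (tensor_mul A B))
    (hBA : normal_CFII (tensor_mul B A))
    (hsym : local_symmetry Rr Th Lr (fun N => mpv N A B)) :
  exists (X : G -> 'M[R[i]]_D1) (Y : G -> 'M[R[i]]_D2),
    [/\ proj_rep gamma X,
        proj_rep (inv_multiplier (inv_multiplier gamma)) Y,
        (continuous Rr -> continuous X),
        (continuous Lr -> continuous Y) &
        forall g : G,
        [/\ forall j, \sum_j' Rr g j j' *: B j' = B j *m X g,
            forall j, \sum_j' Lr g j j' *: B j' = invmx (Y g) *m B j &
            forall i, \sum_i' Th g i i' *: A i' = invmx (X g) *m A i *m Y g]].
Proof.
have [[[L spanL] _] _ _] := hAB.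
have [KAB [OAB [KAB1 OAB1]]] := normal_CFII_dual hAB.
have [KBA [OBA [KBA1 OBA1]]] := normal_CFII_dual hBA.
have KB1 := dual_fam_snd KAB1; have OA1 := dual_fam_fst OAB1.
have KA1 := dual_fam_snd KBA1; have OB1 := dual_fam_fst OBA1.
set KB := fun j => _ in KB1; set OB := fun j => _ in OB1.
have [gamma_mul Ru Rmul] := hRr; have [_ Lu Lmul] := hLr.
have [_ Tu _] := hTh.
have local g : exists XY : 'M[R[i]]_D1 * 'M[R[i]]_D2,
    [/\ XY.1 \is unitarymx, XY.2 \is unitarymx,
        forall j, mix (Rr g) B j = B j *m XY.1,
        forall j, mix (Lr g) B j = invmx XY.2 *m B j &
        forall i, mix (Th g) A i = invmx XY.1 *m A i *m XY.2].
  have BAB j i k : mix (Rr g) B j *m mix (Th g) A i *m mix (Lr g) B k =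
      B j *m A i *m B k.
    (* The leftover factor [A i0] is removed by the left inverse of [A] that comes from [BA]. *)
    apply: (left_cancel KA1) => i0; rewrite !mulmxA.
    exact: (local_symmetry_tensors spanL (hsym L.+2 _ ord0 g)).
  have [X [Y [_ _ BX BY AXY]]] := gauge_intertwiners KA1 OA1 KB1 OB1
    (unitarymx_unit (Ru g)) (unitarymx_unit (Lu g)) BAB.
  have [Xu Yu] := gauge_unitary hAB hBA (Tu g) (Ru g) BX AXY.
  by exists (X, Y).
have {local} [XY XYP] := choice local.
pose X g := (XY g).1; pose Y g := (XY g).2.
have Xu g : X g \is unitarymx by have [] := XYP g.
have Yu g : Y g \is unitarymx by have [] := XYP g.
have BX g j : mix (Rr g) B j = B j *m X g by have [_ _ ->] := XYP g.
have BY g j : mix (Lr g) B j = (Y g)^t* *m B j.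
  by rewrite -invmx_unitary //; have [_ _ _ ->] := XYP g.
(* Although [X] and [Y] come from the axiom of choice, the inverses of [B] express them through
   [Rr g] and [Lr g]; continuity is read off from these formulas. *)
have XE g : X g = \sum_j KB j *m mix (Rr g) B j *m 1%:M.
  transitivity ((\sum_j KB j *m B j) *m X g); first by rewrite KB1 mul1mx.
  rewrite mulmx_suml; apply: eq_bigr => j _.
  by rewrite BX mulmx1 mulmxA.
have YE g : (Y g)^t* = \sum_j 1%:M *m mix (Lr g) B j *m OB j.
  transitivity ((Y g)^t* *m (\sum_j B j *m OB j)).
    by rewrite OB1 mulmx1.
  rewrite mulmx_sumr; apply: eq_bigr => j _.
  by rewrite BY mul1mx mulmxA.
have gammaVV : inv_multiplier (inv_multiplier gamma) = gamma.
  by apply/funext => g; apply/funext => h; rewrite /inv_multiplier invrK.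
exists X, Y; split.
- split=> // g h; apply: (left_cancel KB1) => j.
  rewrite -scalemxAr -BX -mix_scale -Rmul -mix_mul mulmxA -BX -mix_mulr.
  by apply: eq_mix => k; rewrite BX.
- rewrite gammaVV; split=> // g h.
  (* Acting on the left of [B] reverses the order of the factors; taking adjoints restores it. *)
  have YY : (Y h)^t* *m (Y g)^t* = (gamma g h)^-1 *: (Y (g * h)%g)^t*.
    apply: (right_cancel OB1) => j.
    rewrite -scalemxAl -BY -mix_scale -Lmul -mix_mul -mulmxA -BY -mix_mull.
    by apply: eq_mix => k; rewrite BY.
  have [gamma1 _ _ _] := gamma_mul.
  rewrite -[Y g *m Y h]trmxCK adjmxM YY adjmxZ trmxCK; congr (_ *: _).
  (* The conjugate of the inverse of [gamma g h] is [gamma g h] itself, as its modulus is 1. *)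
  by rewrite invC_norm gamma1 expr1n invr1 mul1r conjCK.
- move=> Rc; rewrite (_ : X = fun g => \sum_j KB j *m mix (Rr g) B j *m 1%:M).
    exact: continuous_mix_sum.
  exact/funext.
- move=> Lc; rewrite (_ : Y =
      fun g => (\sum_j 1%:M *m mix (Lr g) B j *m OB j)^t*).
    exact/continuous_adjmx/continuous_mix_sum.
  by apply/funext => g; rewrite -YE trmxCK.
- by move=> g; have [_ _ ? ? ?] := XYP g.
Qed.
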